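(* Let $T_n\subseteq{}^{\omega>}2$ (for $n<\omega$) be trees with no maximal nodes, $\bar{T}=\langle T_n:n<\omega\rangle$, $B=\bigcup_{n<\omega}\lim(T_n)$, and let $2\leq\iota<\omega$, $k=2\iota$. Let $\varepsilon\leq\omega_1$ be an ordinal and $\lambda$ an uncountable cardinal such that ${\rm Pr}_\varepsilon(\lambda)$ holds. If there is $A\subseteq{}^{\omega}2$ of cardinality $\lambda$ such that $|(B+\eta)\cap(B+\nu)|\geq k$ for all $\eta,\nu\in A$, then ${\rm NDRK}(\bar{T})\geq\varepsilon$.
   Context: ${}^{\omega>}2$ is the set of finite 0-1 sequences, ${}^{\ell}2$ those of length $\ell$; ${}^{\omega}2$ is the Cantor space; $+$ is coordinatewise addition modulo 2; $\nu\vartriangleleft\eta$ means that $\nu$ is a proper initial segment of $\eta$. For a tree $T\subseteq{}^{\omega>}2$, $\lim(T)$ is the set of its infinite branches in ${}^{\omega}2$. For a set $u$, $u^{\langle2\rangle}=\{(x,y)\in u\times u:x\neq y\}$. $\mathbf{M}_{\bar{T},k}$ consists of all tuples $\mathbf{m}=(\ell_{\mathbf{m}},u_{\mathbf{m}},\bar{h}_{\mathbf{m}},\bar{g}_{\mathbf{m}})=(\ell,u,\bar{h},\bar{g})$ such that: (i) $0<\ell<\omega$, $u\subseteq{}^{\ell}2$ and $2\leq|u|$; (ii) $\bar{h}=\langle h_i:i<\iota\rangle$, $\bar{g}=\langle g_i:i<\iota\rangle$, with $h_i:u^{\langle2\rangle}\to\omega$ and $g_i:u^{\langle2\rangle}\to\bigcup_{n<\omega}(T_n\cap{}^{\ell}2)$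 for each $i<\iota$; (iii) $g_i(\eta,\nu)\in T_{h_i(\eta,\nu)}\cap{}^{\ell}2$ for all $(\eta,\nu)\in u^{\langle2\rangle}$, $i<\iota$; (iv) $\eta+g_i(\eta,\nu)=\nu+g_i(\nu,\eta)$ for all $(\eta,\nu)\in u^{\langle2\rangle}$, $i<\iota$; (v) for any $(\eta,\nu)\in u^{\langle2\rangle}$ there are no repetitions in the sequence $\langle g_i(\eta,\nu),g_i(\nu,\eta):i<\iota\rangle$. The components of $\bar h_{\mathbf m},\bar g_{\mathbf m}$ are written $h^{\mathbf m}_i,g^{\mathbf m}_i$. Extension: $\mathbf{m}\sqsubseteq\mathbf{n}$ iff $\ell_{\mathbf{m}}\leq\ell_{\mathbf{n}}$, $u_{\mathbf{m}}=\{\eta\restriction\ell_{\mathbf{m}}:\eta\in u_{\mathbf{n}}\}$, and for every $(\eta,\nu)\in(u_{\mathbf{n}})^{\langle2\rangle}$ with $\eta\restriction\ell_{\mathbf{m}}\neq\nu\restriction\ell_{\mathbf{m}}$ and each $i<\iota$: $h^{\mathbf{m}}_i(\eta\restriction\ell_{\mathbf{m}},\nu\restriction\ell_{\mathbf{m}})=h^{\mathbf{n}}_i(\eta,\nu)$ and $g^{\mathbf{m}}_i(\eta\restriction\ell_{\mathbf{m}},\nu\restriction\ell_{\mathbf{m}})=g^{\mathbf{n}}_i(\eta,\nu)\restriction\ell_{\mathbf{m}}$. Rank ${\rm ndrk}:\mathbf{M}_{\bar{T},k}\to{\rm ON}\cup\{\infty\}$, defined by declaring inductively when ${\rm ndrk}(\mathbf{m})\geq\alpha$: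 ${\rm ndrk}(\mathbf{m})\geq0$ always; for limit $\alpha$, ${\rm ndrk}(\mathbf{m})\geq\alpha$ iff ${\rm ndrk}(\mathbf{m})\geq\beta$ for all $\beta<\alpha$; ${\rm ndrk}(\mathbf{m})\geq\beta+1$ iff for every $\nu\in u_{\mathbf{m}}$ there is $\mathbf{n}\in\mathbf{M}_{\bar{T},k}$ with $\ell_{\mathbf{n}}>\ell_{\mathbf{m}}$, $\mathbf{m}\sqsubseteq\mathbf{n}$, ${\rm ndrk}(\mathbf{n})\geq\beta$ and $|\{\eta\in u_{\mathbf{n}}:\nu\vartriangleleft\eta\}|\geq2$; ${\rm ndrk}(\mathbf{m})=\infty$ iff ${\rm ndrk}(\mathbf{m})\geq\alpha$ for all ordinals $\alpha$. ${\rm NDRK}(\bar{T})=\sup\{{\rm ndrk}(\mathbf{m})+1:\mathbf{m}\in\mathbf{M}_{\bar{T},k}\}$ (with $\infty+1=\infty$). Model rank. Let $\mathbb{M}$ be a model with universe a cardinal $\lambda$ and a countable vocabulary $\tau$. For finite non-empty $w=\{a_0,\ldots,a_n\}\subseteq\lambda$ with $|w|=n+1$, define ${\rm rk}(w,\mathbb{M})\geq\alpha$ by induction on ordinals $\alpha$: - ${\rm rk}(w,\mathbb{M})\geq 0$ iff for every quantifier free formula $\varphi\in\mathcal{L}(\tau)$ and each $j\leq n$, if $\mathbb{M}\models\varphi[a_0,\ldots,a_j,\ldots,a_n]$ then the set $\{a\in\lambda:\mathbb{M}\models\varphi[a_0,\ldots,a_{j-1},a,a_{j+1},\ldots,a_n]\}$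 is uncountable; - for limit $\alpha$, ${\rm rk}(w,\mathbb{M})\geq\alpha$ iff ${\rm rk}(w,\mathbb{M})\geq\beta$ for all $\beta<\alpha$; - ${\rm rk}(w,\mathbb{M})\geq\alpha+1$ iff for every quantifier free $\varphi\in\mathcal{L}(\tau)$ and each $j\leq n$, if $\mathbb{M}\models\varphi[a_0,\ldots,a_j,\ldots,a_n]$ then there is $a^*\in\lambda\setminus w$ with ${\rm rk}(w\cup\{a^*\},\mathbb{M})\geq\alpha$ and $\mathbb{M}\models\varphi[a_0,\ldots,a_{j-1},a^*,a_{j+1},\ldots,a_n]$. ${\rm rk}(w,\mathbb{M})=-1$ if not ${\rm rk}(w,\mathbb{M})\geq0$; $=\infty$ if ${\rm rk}(w,\mathbb{M})\geq\alpha$ for all $\alpha$; $=\alpha$ if ${\rm rk}(w,\mathbb{M})\geq\alpha$ but not $\geq\alpha+1$. ${\rm NPr}_{\varepsilon}(\lambda)$ says: there is a model $\mathbb{M}^*$ with universe $\lambda$ and a countable vocabulary such that $\sup\{{\rm rk}(w,\mathbb{M}^* ):\emptyset\neq w\in[\lambda]^{<\omega}\}<\varepsilon$; ${\rm Pr}_\varepsilon(\lambda)$ is its negation. *)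

(* Defs.v *)
From mathcomp Require Import all_boot finmap.
From mathcomp Require Import boolp classical_sets functions cardinality.
Set Implicit Arguments.
Unset Strict Implicit.
Unset Printing Implicit Defensive.

Local Open Scope classical_set_scope.
Local Open Scope card_scope.

(* An ordinal is represented by a well-ordered type; two of them denote the
   same ordinal when they are isomorphic ([on_iso]). *)
Record ON : Type := MkON {
  on_sort :> Type;
  olt : on_sort -> on_sort -> Prop;
  olt_wf : well_founded olt;
  olt_trans : forall x y z, olt x y -> olt y z -> olt x z;
  olt_total : forall x y, olt x y \/ x = y \/ olt y x }.

Definition on_iso (a b : ON) : Prop :=
  exists f : a -> b, bijective f /\ forall x y, olt x y <-> olt (f x) (f y).

Section Segment.
Variables (a : ON) (x : a).

Definition seg_lt (y z : {y : a | olt y x}) : Prop := olt (sval y) (sval z).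

Lemma seg_lt_wf : well_founded seg_lt.
Proof.
move=> [y yx]; elim/(well_founded_ind (@olt_wf a)): y yx => y IH yx.
by constructor=> -[z zx] zy; exact: IH.
Qed.

Lemma seg_lt_trans y z t : seg_lt y z -> seg_lt z t -> seg_lt y t.
Proof. exact: olt_trans. Qed.

Lemma seg_lt_total y z : seg_lt y z \/ y = z \/ seg_lt z y.
Proof.
case: y z => [y yx] [z zx]; case: (olt_total y z) => [yz|[yz|zy]].
- by left.
- by right; left; subst z; congr exist; exact: Prop_irrelevance.
- by right; right.
Qed.

Definition seg : ON := MkON seg_lt_wf seg_lt_trans seg_lt_total.
End Segment.

Definition on_lt (a b : ON) : Prop := exists y : b, on_iso a (seg y).
Definition on_le (a b : ON) : Prop := on_lt a b \/ on_iso a b.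

Lemma void_lt_wf : well_founded (fun _ _ : void => False).
Proof. by case. Qed.

Definition on0 : ON :=
  @MkON void (fun _ _ => False) void_lt_wf
    (fun x => match x with end) (fun x => match x with end).

Section Successor.
Variable a : ON.

(* [None] is put on top of [a]. *)
Definition succ_lt (x y : option a) : Prop :=
  match x, y with
  | Some x, Some y => olt x y
  | Some _, None => True
  | None, _ => False
  end.

Lemma succ_lt_wf : well_founded succ_lt.
Proof.
have accS y : Acc succ_lt (Some y).
  elim/(well_founded_ind (@olt_wf a)): y => y IH.
  by apply: Acc_intro => -[z zy|[]]; exact: IH.
case=> [y|]; first exact: accS.
by apply: Acc_intro => -[z _|[]]; exact: accS.
Qed.

Lemma succ_lt_trans x y z : succ_lt x y -> succ_lt y z -> succ_lt x z.
Proof. by move: x y z => [x|] [y|] [z|] //=; exact: olt_trans. Qed.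

Lemma succ_lt_total x y : succ_lt x y \/ x = y \/ succ_lt y x.
Proof.
move: x y => [x|] [y|] /=; try tauto.
by case: (olt_total x y) => [|[->|]]; tauto.
Qed.

Definition onS : ON := MkON succ_lt_wf succ_lt_trans succ_lt_total.
End Successor.

Definition on_limit (a : ON) : Prop :=
  ~ on_iso a on0 /\ forall b, ~ on_iso a (onS b).

Definition is_omega1 (a : ON) : Prop :=
  ~ countable [set: a] /\ forall b, on_lt b a -> countable [set: b].

Definition is_cardinal (a : ON) : Prop :=
  forall b, on_lt b a -> ~ ([set: b] #= [set: a]).

(* ON together with infinity *)
Inductive ONinf : Type := Fin of ON | Infty.

Definition oi_le (x y : ONinf) : Prop :=
  match x, y with
  | Fin a, Fin b => on_le a b
  | _, Infty => True
  | Infty, Fin _ => False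
  end.

Definition oi_succ (x : ONinf) : ONinf := if x is Fin a then Fin (onS a) else Infty.

(* In [option ONinf] the value [None] stands for -1. *)
Definition rv_le (x y : option ONinf) : Prop :=
  match x, y with
  | None, _ => True
  | Some x, Some y => oi_le x y
  | Some _, None => False
  end.

Definition rv_lt (x y : option ONinf) : Prop := rv_le x y /\ ~ rv_le y x.

Definition is_sup {V : Type} (le : V -> V -> Prop) (S : set V) (s : V) : Prop :=
  (forall v, S v -> le v s) /\ forall t, (forall v, S v -> le v t) -> le s t.

Definition proper_initial (s t : seq bool) : bool := prefix s t && (s != t).

Definition is_tree (T : set (seq bool)) : Prop :=
  forall s t, T t -> prefix s t -> T s.

Definition no_maximal_nodes (T : set (seq bool)) : Prop :=
  forall s, T s -> exists2 t, T t & proper_initial s t.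

Definition tree_lim (T : set (seq bool)) : set (nat -> bool) :=
  [set x | forall n, T (mkseq x n)].

Definition cadd (x y : nat -> bool) : nat -> bool := fun n => x n (+) y n.

Definition translate (B : set (nat -> bool)) (y : nat -> bool) : set (nat -> bool) :=
  [set cadd x y | x in B].

(* only used for sequences of the same length *)
Definition sadd (s t : seq bool) : seq bool := [seq p.1 (+) p.2 | p <- zip s t].

(* The functions h_i, g_i are total here; only their values at pairs of distinct
   elements of [mu] are ever constrained or used. *)
Record mtuple (iota : nat) : Type := MkM {
  ml : nat;
  mu : {fset seq bool};
  mh : 'I_iota -> seq bool -> seq bool -> nat;
  mg : 'I_iota -> seq bool -> seq bool -> seq bool }.

Definition inM (T : nat -> set (seq bool)) (iota : nat) (m : mtuple iota) : Prop :=
  [/\ 0 < ml m,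
      forall eta, eta \in mu m -> size eta = ml m,
      2 <= #|` mu m|
    & forall eta nu, eta \in mu m -> nu \in mu m -> eta != nu ->
      [/\ forall i, T (mh m i eta nu) (mg m i eta nu) /\ size (mg m i eta nu) = ml m,
          forall i, sadd eta (mg m i eta nu) = sadd nu (mg m i nu eta)
        & uniq (codom (fun i => mg m i eta nu) ++ codom (fun i => mg m i nu eta))]].

Definition mext (iota : nat) (m n : mtuple iota) : Prop :=
  [/\ ml m <= ml n,
      mu m = [fset take (ml m) eta | eta in mu n]%fset
    & forall eta nu, eta \in mu n -> nu \in mu n ->
        take (ml m) eta != take (ml m) nu -> forall i,
        mh m i (take (ml m) eta) (take (ml m) nu) = mh n i eta nu /\
        mg m i (take (ml m) eta) (take (ml m) nu) = take (ml m) (mg n i eta nu)].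

Inductive ndrk_ge (T : nat -> set (seq bool)) (iota : nat) :
    ON -> mtuple iota -> Prop :=
| NdrkZero (a : ON) (m : mtuple iota) :
    on_iso a on0 -> ndrk_ge T a m
| NdrkLimit (a : ON) (m : mtuple iota) :
    on_limit a -> (forall b, on_lt b a -> ndrk_ge T b m) -> ndrk_ge T a m
| NdrkSucc (a b : ON) (m : mtuple iota) :
    on_iso a (onS b) ->
    (forall nu, nu \in mu m -> exists n : mtuple iota,
       [/\ inM T n, ml m < ml n, mext m n, ndrk_ge T b n
         & 2 <= #|` [fset eta in mu n | proper_initial nu eta]%fset |]) ->
    ndrk_ge T a m.

Definition is_ndrk (T : nat -> set (seq bool)) (iota : nat) (m : mtuple iota)
    (v : ONinf) : Prop :=
  match v with
  | Fin a => ndrk_ge T a m /\ ~ ndrk_ge T (onS a) m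
  | Infty => forall a, ndrk_ge T a m
  end.

Definition is_NDRK (T : nat -> set (seq bool)) (iota : nat) (s : ONinf) : Prop :=
  is_sup oi_le
    [set oi_succ v | v in [set v | exists2 m : mtuple iota, inM T m & is_ndrk T m v]] s.

Record vocabulary : Type := Vocabulary {
  rel_sym : countType;
  rel_ar : rel_sym -> nat;
  fun_sym : countType;
  fun_ar : fun_sym -> nat }.

Record model (tau : vocabulary) (X : Type) : Type := Model {
  rel_int : forall r : rel_sym tau, ('I_(rel_ar r) -> X) -> Prop;
  fun_int : forall f : fun_sym tau, ('I_(fun_ar f) -> X) -> X }.

Inductive term (tau : vocabulary) (n : nat) : Type :=
| Var of 'I_n
| App (f : fun_sym tau) of ('I_(fun_ar f) -> term tau n).

(* quantifier free formulas with variables indexed by ['I_n] *)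
Inductive qf_formula (tau : vocabulary) (n : nat) : Type :=
| FEq of term tau n & term tau n
| FRel (r : rel_sym tau) of ('I_(rel_ar r) -> term tau n)
| FNot of qf_formula tau n
| FAnd of qf_formula tau n & qf_formula tau n.

Fixpoint eval (tau : vocabulary) (X : Type) (M : model tau X) (n : nat)
    (a : 'I_n -> X) (t : term tau n) : X :=
  match t with
  | Var i => a i
  | App f ts => fun_int M (fun i => eval M a (ts i))
  end.

Fixpoint sat (tau : vocabulary) (X : Type) (M : model tau X) (n : nat)
    (phi : qf_formula tau n) (a : 'I_n -> X) : Prop :=
  match phi with
  | FEq s t => eval M a s = eval M a t
  | FRel r ts => rel_int M (fun i => eval M a (ts i))
  | FNot p => ~ sat M p a
  | FAnd p q => sat M p a /\ sat M q a
  end.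

Definition upd (X : Type) (n : nat) (a : 'I_n -> X) (j : 'I_n) (x : X) : 'I_n -> X :=
  fun i => if i == j then x else a i.

Definition enumerates (X : Type) (n : nat) (a : 'I_n.+1 -> X) (w : set X) : Prop :=
  injective a /\ range a = w.

(* The clauses quantify over all repetition-free enumerations of [w]; as
   formulas may have their variables renamed, this agrees with fixing one. *)
Inductive rk_ge (tau : vocabulary) (X : Type) (M : model tau X) :
    ON -> set X -> Prop :=
| RkZero (a : ON) (w : set X) :
    on_iso a on0 ->
    (forall n (e : 'I_n.+1 -> X), enumerates e w ->
       forall (phi : qf_formula tau n.+1) (j : 'I_n.+1), sat M phi e ->
       ~ countable [set x | sat M phi (upd e j x)]) ->
    rk_ge M a w
| RkLimit (a : ON) (w : set X) :
    on_limit a -> (forall b, on_lt b a -> rk_ge M b w) -> rk_ge M a w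
| RkSucc (a b : ON) (w : set X) :
    on_iso a (onS b) ->
    (forall n (e : 'I_n.+1 -> X), enumerates e w ->
       forall (phi : qf_formula tau n.+1) (j : 'I_n.+1), sat M phi e ->
       exists x, [/\ ~ w x, rk_ge M b (w `|` [set x]) & sat M phi (upd e j x)]) ->
    rk_ge M a w.

Definition is_rk (tau : vocabulary) (X : Type) (M : model tau X) (w : set X)
    (v : option ONinf) : Prop :=
  match v with
  | None => ~ rk_ge M on0 w
  | Some (Fin a) => rk_ge M a w /\ ~ rk_ge M (onS a) w
  | Some Infty => forall a, rk_ge M a w
  end.

Definition NPr (eps lam : ON) : Prop :=
  exists (tau : vocabulary) (M : model tau lam) (s : option ONinf),
    is_sup rv_le
      [set v | exists w : set lam, [/\ finite_set w, w !=set0 & is_rk M w v]] s /\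
    rv_lt s (Some (Fin eps)).

Definition Pr (eps lam : ON) : Prop := ~ NPr eps lam.

(* Main.v *)
(* If [NDRK T] were some ordinal [b < eps], then a model on [lam] would witness
   [NPr eps lam].  Index [A] by [lam] as [eta], and for [a <> c] pick [iota]
   points of [(B + eta a) :&: (B + eta c)] giving [g_i(a, c)], [h_i(a, c)]
   symmetrically.  The relations of the model record, for every level [l] and
   finite tuple [e], the restrictions to [l] of the [eta (e p)] and of the
   [g_i (e p) (e q)], with the [h_i (e p) (e q)].  If [m] is read off [e] in
   this way, a point [x] witnessing the successor step of [rk] for [e j] splits
   the node [eta (e j)] of [m] at a higher level, so the model rank of a set
   with at least two points is at most [ndrk m < b]; the rank of a singleton
   is then at most [b]. *)
Require Import Defs.
From mathcomp Require Import all_boot finmap.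
From mathcomp Require Import boolp classical_sets functions cardinality.
Local Open Scope classical_set_scope.
Local Open Scope card_scope.
Set Implicit Arguments.
Unset Strict Implicit.
Unset Printing Implicit Defensive.

(** * Isomorphism and comparison of ordinals *)

Lemma on_iso_refl a : on_iso a a.
Proof. by exists id; split=> //; exists id. Qed.

Lemma on_iso_sym a b : on_iso a b -> on_iso b a.
Proof.
move=> [f [[g fK gK] fP]]; exists g; split; first by exists f.
by move=> x y; rewrite fP !gK.
Qed.

Lemma on_iso_trans a b c : on_iso a b -> on_iso b c -> on_iso a c.
Proof.
move=> [f [bf fP]] [g [bg gP]]; exists (g \o f); split; first exact: bij_comp.
by move=> x y; rewrite fP gP.
Qed.

Lemma olt_irr (a : ON) (x : a) : ~ olt x x.
Proof. by elim/(well_founded_ind (@olt_wf a)): x => x IH xx; exact: (IH x). Qed.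

(** Totality of the order on [a] makes a strictly increasing map injective and order reflecting, so
    only surjectivity is left to check. *)
Lemma on_iso_onto (a b : ON) (f : a -> b) :
  (forall x y, olt x y -> olt (f x) (f y)) -> (forall z, exists x, f x = z) ->
  on_iso a b.
Proof.
move=> f_mono /choice[g gK].
have lt_f x y : olt x y <-> olt (f x) (f y).
  split=> [|fxy]; first exact: f_mono.
  case: (olt_total x y) => [//|[xy|/f_mono yx]].
    by subst y; case: (olt_irr fxy).
  by case: (olt_irr (olt_trans fxy yx)).
have f_inj x y : f x = f y -> x = y.
  move=> fxy; case: (olt_total x y) => [|[//|]] /f_mono; rewrite fxy => /olt_irr [].
by exists f; split=> //; exists g => [x|//]; apply: f_inj; rewrite gK.
Qed.

Lemma on_iso_onto_seg (a b : ON) (f : a -> b) (y : b) :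
  (forall u v, olt u v -> olt (f u) (f v)) -> (forall u, olt (f u) y) ->
  (forall z, olt z y -> exists u, f u = z) -> on_iso a (seg y).
Proof.
move=> f_mono f_y f_onto.
apply: (@on_iso_onto a (seg y) (fun u => exist _ (f u) (f_y u))) => [u v /f_mono//|].
by move=> [z zy]; have [u fuz] := f_onto z zy; exists u; exact: eq_exist.
Qed.

Lemma seg_seg (a : ON) (x : a) (y : seg x) : on_iso (seg y) (seg (sval y)).
Proof.
apply: (@on_iso_onto_seg (seg y) a (fun z => sval (sval z))) => // [[z zy]//|z zy].
by exists (exist _ (exist _ z (olt_trans zy (svalP y))) zy).
Qed.

Lemma on_lt_seg (a : ON) (x y : a) : olt x y -> on_lt (seg x) (seg y).
Proof. by move=> xy; exists (exist _ x xy); exact/on_iso_sym/seg_seg. Qed.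

Lemma on_iso_seg (a b : ON) (x : a) :
  on_iso a b -> exists y : b, on_iso (seg x) (seg y).
Proof.
move=> [f [[g fK gK] fP]]; exists (f x).
apply: (@on_iso_onto_seg (seg x) b (fun z => f (sval z))).
- by move=> u v /fP.
- by move=> [u ux]; apply/fP.
- move=> z zfx; have gzx : olt (g z) x by rewrite fP gK.
  by exists (exist (fun u => olt u x) _ gzx) => /=.
Qed.

Lemma on_lt_iso (a b c : ON) : on_lt a b -> on_iso b c -> on_lt a c.
Proof.
move=> [y ay] /(on_iso_seg y)[z yz]; exists z; exact: on_iso_trans ay yz.
Qed.

Lemma on_iso_lt (a b c : ON) : on_iso a b -> on_lt b c -> on_lt a c.
Proof. by move=> ab [y byP]; exists y; exact: on_iso_trans byP. Qed.

Lemma on_lt_trans (a b c : ON) : on_lt a b -> on_lt b c -> on_lt a c.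
Proof.
move=> [y ay] [z bz]; have [t yt] := on_iso_seg y bz; exists (sval t).
exact: on_iso_trans (on_iso_trans ay yt) (seg_seg t).
Qed.

(** Everything below [a] is isomorphic to some [seg x], and accessibility passes along isomorphisms,
    so induction on [x] inside [a] settles the segments first. *)
Lemma on_lt_wf : well_founded on_lt.
Proof.
have Acc_iso a b : on_iso a b -> Acc on_lt a -> Acc on_lt b.
  by move=> /on_iso_sym ba [Acca]; constructor=> c cb; exact/Acca/(on_lt_iso cb).
have Acc_seg (a : ON) (x : a) : Acc on_lt (seg x).
  elim/(well_founded_ind (@olt_wf a)): x => x IH; constructor=> b [y ay].
  apply: (Acc_iso _ _ (on_iso_sym ay)); apply: (Acc_iso _ _ (on_iso_sym (seg_seg y))).
  exact: IH (svalP y).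
by move=> a; constructor=> b [y /on_iso_sym yb]; exact: Acc_iso yb (Acc_seg a y).
Qed.

Lemma on_lt_irr a : ~ on_lt a a.
Proof. by elim/(well_founded_ind on_lt_wf): a => a IH aa; exact: (IH a). Qed.

Lemma on_min (P : ON -> Prop) :
  (exists a, P a) -> exists a, P a /\ forall b, on_lt b a -> ~ P b.
Proof.
move=> [a Pa]; apply: contrapT => nomin; elim/(well_founded_ind on_lt_wf): a Pa => a IH Pa.
by apply: nomin; exists a; split=> // b ba; exact: IH.
Qed.

Lemma seg_inj (a : ON) (x y : a) : on_iso (seg x) (seg y) -> x = y.
Proof.
move=> xy; case: (olt_total x y) => [/on_lt_seg lt_xy|[//|/on_lt_seg lt_yx]].
- by case: (on_lt_irr (on_lt_iso lt_xy (on_iso_sym xy))).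
- by case: (on_lt_irr (on_lt_iso lt_yx xy)).
Qed.

Lemma seg_lt_inv (a : ON) (x y : a) : on_lt (seg x) (seg y) -> olt x y.
Proof.
by move=> [z /on_iso_trans/(_ (seg_seg z))/seg_inj ->]; case: z.
Qed.

(** Unless [b] lies below [a], induction matches each segment of [a] with a segment of [b]. The
    resulting map is strictly increasing with downward closed range, so it is either onto [b] or an
    isomorphism onto the segment below the least missed point. *)
Lemma on_trichotomy (a b : ON) : on_lt a b \/ on_iso a b \/ on_lt b a.
Proof.
elim/(well_founded_ind on_lt_wf): a b => a IH b.
have [//|nba] := pselect (on_lt b a); first by right; right.
have [f fP] : exists f : a -> b, forall x, on_iso (seg x) (seg (f x)).
  suff /choice[f fP] : forall x : a, exists y : b, on_iso (seg x) (seg y) by exists f.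
  move=> x.
  have xa : on_lt (seg x) a by exists x; exact: on_iso_refl.
  case: (IH _ xa b) => [//|[xb|bx]]; case: nba.
  - by exists x; exact: on_iso_sym.
  - exact: on_lt_trans bx xa.
have f_mono x y : olt x y -> olt (f x) (f y).
  move=> /on_lt_seg xy; apply: seg_lt_inv.
  exact: on_iso_lt (on_iso_sym (fP x)) (on_lt_iso xy (fP y)).
have f_down x z : olt z (f x) -> exists y, f y = z.
  move=> /on_lt_seg /on_lt_iso/(_ (on_iso_sym (fP x)))[y zy].
  exists (sval y); apply: seg_inj; apply: on_iso_trans (on_iso_sym (fP _)) _.
  exact/on_iso_sym/(on_iso_trans zy)/seg_seg.
have [/(on_iso_onto f_mono) ab|] := pselect (forall z, exists x, f x = z).
  by right; left.
move=> /existsNP[z0 Nz0]; left.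
have [z [Nz zmin]] : exists z, ~ (exists x, f x = z) /\
    forall t, olt t z -> exists x, f x = t.
  apply: contrapT => nomin; elim/(well_founded_ind (@olt_wf b)): z0 Nz0 => z IHz Nz.
  apply: nomin; exists z; split=> // t tz; apply: contrapT => Nt; exact: (IHz t).
exists z; apply: on_iso_onto_seg zmin => // x.
case: (olt_total (f x) z) => [//|[fxz|/f_down //]].
by case: Nz; exists x.
Qed.

Lemma on_leNgt a b : on_le a b <-> ~ on_lt b a.
Proof.
split=> [ab ba|nba].
  case: ab => [/on_lt_trans/(_ ba)|ab]; first exact: on_lt_irr.
  exact: on_lt_irr (on_iso_lt ab ba).
by case: (on_trichotomy a b) => [?|[?|//]]; [left|right].
Qed.

Lemma on_lt_le_trans a b c : on_lt a b -> on_le b c -> on_lt a c.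
Proof. by move=> ab [/(on_lt_trans ab)|/(on_lt_iso ab)]. Qed.

Lemma on_le_lt_trans a b c : on_le a b -> on_lt b c -> on_lt a c.
Proof. by move=> [/on_lt_trans|/on_iso_lt] /[apply]. Qed.

Lemma on0_min a : ~ on_lt a on0.
Proof. by case=> -[]. Qed.

Lemma on_lt_onS a : on_lt a (onS a).
Proof.
exists (None : onS a).
by apply: (@on_iso_onto_seg a (onS a) some) => // -[z|//] _; exists z.
Qed.

Lemma on_lt_onSE a b : on_lt a (onS b) <-> on_le a b.
Proof.
split=> [[[y|] ay]|ab]; last exact: on_le_lt_trans ab (on_lt_onS b).
- left; exists y; apply: on_iso_trans ay (on_iso_sym _).
  apply: (@on_iso_onto_seg (seg y) (onS b) (fun z => Some (sval z))) => //.
    by case.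
  by move=> [z|//] zy; exists (exist _ z zy).
- right; apply: on_iso_trans ay (on_iso_sym _).
  by apply: (@on_iso_onto_seg b (onS b) some) => // -[z|//] _; exists z.
Qed.

Lemma on_leSE a b : on_le (onS a) b <-> on_lt a b.
Proof.
split=> [/(on_lt_le_trans (on_lt_onS a))//|ab].
by apply/on_leNgt => /on_lt_onSE /on_leNgt.
Qed.

Lemma on_lt_limitS a b : on_limit a -> on_lt b a -> on_lt (onS b) a.
Proof. by move=> [_ aS] /on_leSE[//|/on_iso_sym /aS]. Qed.

Lemma on_limit_iso a b : on_iso a b -> on_limit a -> on_limit b.
Proof.
move=> ab [a0 aS]; split=> [b0|c bc].
- by apply: a0; exact: on_iso_trans b0.
- by apply: (aS c); exact: on_iso_trans bc.
Qed.

Lemma on_cases a : on_iso a on0 \/ on_limit a \/ exists b, on_iso a (onS b).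
Proof.
have [|a0] := pselect (on_iso a on0); first by left.
have [|aS] := pselect (exists b, on_iso a (onS b)); first by right; right.
by right; left; split=> // b ab; apply: aS; exists b.
Qed.

(** * Suprema of rank values *)

Lemma is_sup_exists (V : Type) (le : V -> V -> Prop) :
  (forall P : set V, P !=set0 -> exists2 x, P x & forall y, P y -> le x y) ->
  forall S : set V, (exists t, forall v, S v -> le v t) -> exists s, is_sup le S s.
Proof.
move=> least S ubS; have [s Ss s_least] := least [set t | forall v, S v -> le v t] ubS.
by exists s.
Qed.

Lemma oi_least (P : set ONinf) : P !=set0 -> exists2 x, P x & forall y, P y -> oi_le x y.
Proof.
move=> [x Px]; have [/on_min[a [Pa amin]]|Pinf] := pselect (exists a, P (Fin a)).
  by exists (Fin a) => // -[b|//] Pb; apply/on_leNgt => /amin.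
case: x Px => [a Pa|Px]; first by case: Pinf; exists a.
by exists Infty => // -[b Pb|//]; apply: Pinf; exists b.
Qed.

Lemma rv_least (P : set (option ONinf)) :
  P !=set0 -> exists2 x, P x & forall y, P y -> rv_le x y.
Proof.
move=> [x Px]; have [Pnone|Nnone] := pselect (P None); first by exists None.
case: x Px => [x|//] Px.
have [|y Py y_least] := @oi_least [set x | P (Some x)]; first by exists x.
by exists (Some y) => // -[z /y_least|/Nnone].
Qed.

Lemma oi_le_infty x : oi_le x Infty.
Proof. by case: x. Qed.

(** * The rank of the tuples in M and its supremum *)

Section NodeRank.
Variables (T : nat -> set (seq bool)) (iota : nat).
Implicit Types (m n : mtuple iota).

Lemma ndrk_ge_iso a b m : on_iso a b -> ndrk_ge T a m -> ndrk_ge T b m.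
Proof.
move=> ab am; have := on_iso_sym ab.
case: am ab => [c {}m c0 _|c {}m c_lim c_lt cb|c d {}m cS c_ext _] bc.
- by apply: NdrkZero; exact: on_iso_trans c0.
- apply: NdrkLimit; first exact: on_limit_iso c_lim.
  by move=> d db; apply: c_lt; exact: on_lt_iso bc.
- by apply: NdrkSucc c_ext; exact: on_iso_trans cS.
Qed.

(** If [c+1] is below [d'+1] then [c] is below [d'], so the extensions witnessing the larger rank
    also witness the smaller one, by induction on [b]. *)
Lemma ndrk_ge_lt a b m : on_lt b a -> ndrk_ge T a m -> ndrk_ge T b m.
Proof.
elim/(well_founded_ind on_lt_wf): b a m => b IH a m ba am.
case: (on_cases b) => [b0|[b_lim|[c bS]]]; first exact: NdrkZero.
  apply: NdrkLimit => // c cb; apply: (IH c cb a) => //.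
  exact: on_lt_trans ba.
have cb : on_lt c b := on_lt_iso (on_lt_onS c) (on_iso_sym bS).
case: am ba => [d {}m d0|d {}m d_lim d_lt|d d' {}m dS d_ext] ba.
- by case: (on0_min (on_lt_iso ba d0)).
- exact: d_lt.
- have cd : on_lt c d'.
    by apply/on_leSE/on_lt_onSE; apply: on_iso_lt (on_lt_iso ba dS); exact: on_iso_sym.
  apply: NdrkSucc bS _ => nu /d_ext[n [nM ln mn nd nu2]]; exists n; split=> //.
  exact: IH cd nd.
Qed.

Lemma ndrk_ge_le a b m : on_le b a -> ndrk_ge T a m -> ndrk_ge T b m.
Proof. by move=> [/ndrk_ge_lt|/on_iso_sym/ndrk_ge_iso]; exact. Qed.

(** The least ordinal not reached can be neither zero nor a limit, so it has a predecessor, and that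
    is the rank. *)
Lemma is_ndrk_exists m : exists v, is_ndrk T m v.
Proof.
have [|/existsNP/on_min[a [Nam amin]]] := pselect (forall a, ndrk_ge T a m).
  by exists Infty.
have [a0|[a_lim|[b aS]]] := on_cases a.
- by case: Nam; exact: NdrkZero.
- by case: Nam; apply: NdrkLimit => // b /amin; exact: contrapT.
exists (Fin b); split; last by move=> /(ndrk_ge_iso (on_iso_sym aS)).
apply: contrapT; apply: amin; exact: on_lt_iso (on_lt_onS b) (on_iso_sym aS).
Qed.

Lemma NDRK_exists : exists s, is_NDRK T iota s.
Proof.
by apply: (is_sup_exists oi_least); exists Infty => v _; exact: oi_le_infty.
Qed.

(** Otherwise the rank of [m] plus one would exceed the supremum [b]. *)
Lemma NDRK_ub b m : is_NDRK T iota (Fin b) -> inM T m -> ~ ndrk_ge T b m.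
Proof.
move=> [ub _] mM bm; have [v mv] := is_ndrk_exists m.
have : oi_le (oi_succ v) (Fin b) by apply: ub; exists v => //; exists m.
by case: v mv => [a [_ NSa] ab|//]; exact/NSa/(ndrk_ge_le ab).
Qed.

End NodeRank.

(** * Addition and restriction in the Cantor space; choice of overlap points *)

Lemma caddC x y : cadd x y = cadd y x.
Proof. by apply/funext => n; exact: addbC. Qed.

Lemma caddA x y z : cadd x (cadd y z) = cadd (cadd x y) z.
Proof. by apply/funext => n; exact: addbA. Qed.

Lemma caddK y : involutive (cadd^~ y).
Proof. by move=> x; apply/funext => n; rewrite /cadd -addbA addbb addbF. Qed.

Lemma cadd_neq x (d : nat -> bool) : (exists n, d n) -> cadd x d <> x.
Proof. by move=> [n dn] /(congr1 (fun f => f n)); rewrite /cadd dn; case: (x n). Qed.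

Lemma translateE B y : translate B y = [set x | B (cadd x y)].
Proof.
apply/seteqP; split=> [_ [x Bx <-]|x Bxy] /=; first by rewrite caddK.
by exists (cadd x y) => //; rewrite caddK.
Qed.

Lemma take_mkseq (U : Type) (f : nat -> U) l n : l <= n -> take l (mkseq f n) = mkseq f l.
Proof. by move=> ln; rewrite /mkseq -map_take take_iota (minn_idPl ln). Qed.

Lemma sadd_mkseq x y l : sadd (mkseq x l) (mkseq y l) = mkseq (cadd x y) l.
Proof.
by rewrite /sadd /mkseq zip_map -map_comp.
Qed.

(** Each of the finitely many pairs of distinct branches differs at some coordinate; any level
    beyond all these coordinates separates them. *)
Lemma mkseq_separate (I : finType) (f : I -> nat -> bool) :
  exists L, forall l, L <= l -> forall i j, mkseq (f i) l = mkseq (f j) l -> f i = f j.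
Proof.
have /choice[d dP] (p : I * I) : exists n, f p.1 <> f p.2 -> f p.1 n <> f p.2 n.
  have [fp|nfp] := pselect (f p.1 = f p.2); first by exists 0.
  by have /existsNP[n] : ~ f p.1 =1 f p.2 by [move=> /funext]; exists n.
exists (\max_p (d p).+1) => l dl i j fij; apply: contrapT => /(dP (i, j)) /=; apply.
have dijl : d (i, j) < l := leq_trans (leq_bigmax (i, j)) dl.
by rewrite -(nth_mkseq false (f i) dijl) fij nth_mkseq.
Qed.

(* Greedy choice: each chosen point [x] forbids only [x] and [x + d]. *)
Lemma pick_translates (S : set (nat -> bool)) (d : nat -> bool) (n : nat) :
  (exists k, d k) -> `I_(2 * n) #<= S ->
  exists x : 'I_n -> nat -> bool,
    [/\ forall i, S (x i), injective x & forall i j, x i <> cadd (x j) d].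
Proof.
move=> d_neq0 /pcard_leP[q].
suff [x xP] : exists x : nat -> nat -> bool, forall i, i < n ->
    S (x i) /\ forall j, j < i -> x i <> x j /\ x i <> cadd (x j) d.
  exists (fun i => x i); split=> [i|i j xij|i j].
  - by have [] := xP i (ltn_ord i).
  - apply: val_inj => /=; case: (ltngtP i j) => // [ij|ji].
      by have [_ /(_ _ ij)[/(_ (esym xij))]] := xP j (ltn_ord j).
    by have [_ /(_ _ ji)[/(_ xij)]] := xP i (ltn_ord i).
  (* Adding [d] is an involution, so excluding [x i = x j + d] at the larger index excludes it in
     both directions. *)
  - case: (ltngtP i j) => [ij|ji|/val_inj ->] xij.
    + have [_ /(_ _ ij)[_ +]] := xP j (ltn_ord j).
      by apply; rewrite xij caddK.
    + by have [_ /(_ _ ji)[_ /(_ xij)]] := xP i (ltn_ord i).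
    + exact: (@cadd_neq (x j) d).
(* Induction on the number [m] of points chosen so far; the supply of [2 * n] points stays fixed. *)
elim: {1 3}n (leqnn n) => [|m IHm] mn; first by exists (fun _ _ => false).
have [x xP] := IHm (ltnW mn).
pose bad := [seq x i | i <- iota 0 m] ++ [seq cadd (x i) d | i <- iota 0 m].
have [y [Sy ybad]] : exists y, S y /\ y \notin bad.
  (* Otherwise the [2 * n] distinct values of [q] would all lie among [2 * m] forbidden points, with
     [m < n]. *)
  apply: contrapT => noy; suff : 2 * n <= size bad.
    by rewrite size_cat !size_map size_iota addnn -mul2n leq_pmul2l // leqNgt mn.
  have <- : size [seq q i | i <- iota 0 (2 * n)] = 2 * n by rewrite size_map size_iota.
  apply: uniq_leq_size.
    rewrite map_inj_in_uniq ?iota_uniq // => i j; rewrite !mem_iota /= !add0n => ilt jlt.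
    by apply: inj; rewrite inE.
  move=> z /mapP[i + ->]; rewrite mem_iota add0n => ilt; apply: contrapT => /negP qbad.
  by apply: noy; exists (q i); split=> //; exact: funS.
exists (fun i => if i == m then y else x i) => i; rewrite ltnS leq_eqVlt.
have neq j : j < m -> (j == m) = false by move=> jm; rewrite ltn_eqF.
case/predU1P => [->|im]; last first.
  rewrite (neq i im); have [Sx x_neq] := xP i im; split=> // j ji.
  by rewrite neq ?(ltn_trans ji) //; exact: x_neq.
rewrite eqxx; split=> // j jm; rewrite neq //.
by split=> yx; move/negP: ybad; apply; rewrite mem_cat; apply/orP; [left|right];
  apply/mapP; exists j; rewrite ?mem_iota.
Qed.

(** With [x i] points of the intersection, put [g i a b = x i + eta a]: both sides of the required
    equation are then [x i]. A repetition [g i a b = g j b a] means [x i = x j + (eta a + eta b)],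
    so the points are picked avoiding the shift by [eta a + eta b]. *)
Lemma overlap_functions (T : nat -> set (seq bool)) (iota : nat) (X : Type)
    (eta : X -> nat -> bool) (B := \bigcup_n tree_lim (T n)) :
  injective eta ->
  (forall a b, `I_(2 * iota) #<= translate B (eta a) `&` translate B (eta b)) ->
  exists (h : 'I_iota -> X -> X -> nat) (g : 'I_iota -> X -> X -> nat -> bool),
    forall a b, a <> b ->
    [/\ forall i, tree_lim (T (h i a b)) (g i a b),
        forall i, cadd (eta a) (g i a b) = cadd (eta b) (g i b a),
        injective (fun i => g i a b)
      & forall i j, g i a b <> g j b a].
Proof.
move=> eta_inj ovl.
pose P a b := [set x : 'I_iota -> nat -> bool |
  [/\ injective x, forall i, B (cadd (x i) (eta a)) /\ B (cadd (x i) (eta b))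
    & forall i j, cadd (x i) (eta a) <> cadd (x j) (eta b)]].
have P_sym a b : P a b `<=` P b a.
  move=> x [xinj xB xneq]; split=> // [i|i j xij]; first by have [] := xB i.
  exact: xneq (esym xij).
(* [P a b] and [P b a] are the same set, so [xget] returns the same points for both orders of the
   pair. *)
pose x a b := xget (fun _ _ => false) (P a b).
have xC a b : x a b = x b a.
  by congr xget; apply/seteqP; split; exact: P_sym.
have xP a b : a <> b -> P a b (x a b).
  move=> ab; apply: xgetPex.
  have : exists k, cadd (eta a) (eta b) k.
    apply: contrapT => /forallNP eab; apply/ab/eta_inj/funext => k.
    by move/negP: (eab k); rewrite /cadd; case: (eta a k); case: (eta b k).
  move=> /pick_translates/(_ (ovl a b))[y [yB yinj yneq]]; exists y; split=> //.
    by move=> i; have := yB i; rewrite !translateE.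
  move=> i j yij; apply: (yneq i j).
  by rewrite [cadd (eta a) _]caddC caddA -yij caddK.
pose g i a b := cadd (x a b i) (eta a).
pose h i a b := xget 0 [set n | tree_lim (T n) (g i a b)].
exists h, g => a b /[dup] ab /xP[xinj xB xneq]; split.
- by move=> i; apply: (@xgetPex _ 0 [set n | tree_lim (T n) (g i a b)]);
    have [[n _ Tn] _] := xB i; exists n.
- by move=> i; rewrite /g xC [cadd (eta a) _]caddC [cadd (eta b) _]caddC !caddK.
- by move=> i j /(congr1 (cadd^~ (eta a))); rewrite !caddK => /xinj.
- by move=> i j; rewrite /g [x b a]xC; exact: xneq.
Qed.

(** * Finite sets and one-point extensions in the model rank *)

Lemma two_le_cardfs (K : choiceType) (A : {fset K}) (x y : K) :
  x \in A -> y \in A -> x != y -> 2 <= #|` A|.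
Proof.
move=> xA yA xy; have <- : #|` [fset x; y]%fset| = 2 by rewrite cardfs2 xy.
by apply: fsubset_leq_card; apply/fsubsetP => z /fset2P[] ->.
Qed.

Lemma enumerates_exists (X : Type) (w : set X) : finite_set w -> w !=set0 ->
  exists n (e : 'I_n.+1 -> X), enumerates e w.
Proof.
move=> [n]; rewrite card_eq_sym => /card_bijP[f [f' fK f'K]].
case: n f f' fK f'K => [|n] f f' fK f'K [y yw].
  by have := f' (SigSub (mem_set yw)) => -[z /set_mem].
pose inI (i : 'I_n.+1) : `I_n.+1 := SigSub (@mem_set _ `I_n.+1 _ (ltn_ord i)).
exists n, (fun i => val (f (inI i))); split.
  by move=> i j /val_inj/(can_inj fK)/(congr1 val)/= /ord_inj.
apply/seteqP; split=> [_ [i _ <-]|z zw]; first exact: set_valP.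
pose i := f' (SigSub (mem_set zw)).
exists (Ordinal (set_valP i : val i < n.+1)) => //.
by rewrite [inI _](_ : _ = i) ?f'K //; exact: val_inj.
Qed.

(** At a limit, replace [a] by [onS b], still below it; at a successor of [c], [b] is at most [c]
    and the successor clause adds a point. *)
Lemma rk_ge_extend (tau : vocabulary) (X : Type) (M : model tau X) (a b : ON)
    (w : set X) (n : nat) (e : 'I_n.+1 -> X) :
  enumerates e w -> on_lt b a -> rk_ge M a w ->
  exists c x, [/\ on_le b c, ~ w x & rk_ge M c (w `|` [set x])].
Proof.
elim/(well_founded_ind on_lt_wf): a w => a IH w ew ba aw.
case: aw IH ew ba => [d {}w d0 _|d {}w d_lim d_lt|d c {}w dS ext] IH ew bd.
- by case: (on0_min (on_lt_iso bd d0)).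
- have Sbd := on_lt_limitS d_lim bd.
  exact: IH Sbd _ ew (on_lt_onS b) (d_lt _ Sbd).
(* An always true formula is enough, as only a new point is wanted. *)
- have [//|x [xw c_rk _]] := ext _ e ew (FEq (Var tau ord0) (Var tau ord0)) ord0.
  by exists c, x; split=> //; apply/on_lt_onSE; exact: on_lt_iso dS.
Qed.

(** * The model coding the overlaps, and the comparison of the two ranks *)

Section OverlapModel.
Variables (T : nat -> set (seq bool)) (iota : nat) (X : Type).
Variables (eta : X -> nat -> bool).
Variables (h : 'I_iota -> X -> X -> nat) (g : 'I_iota -> X -> X -> nat -> bool).
Hypothesis eta_inj : injective eta.
Hypothesis ovl : forall a b, a <> b ->
    [/\ forall i, tree_lim (T (h i a b)) (g i a b),
        forall i, cadd (eta a) (g i a b) = cadd (eta b) (g i b a),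
        injective (fun i => g i a b)
      & forall i j, g i a b <> g j b a].

Definition code_type (N : nat) : countType :=
  (nat * {ffun 'I_N -> seq bool}
   * {ffun 'I_iota * 'I_N * 'I_N -> nat * seq bool})%type.

(** The branches are cut at level [l], while the values of [h] are kept in full, since [mext]
    requires them to be preserved exactly. All the data are finite, which keeps the vocabulary
    countable. *)
Definition code (l N : nat) (a : 'I_N -> X) : code_type N :=
  (l, [ffun p => mkseq (eta (a p)) l],
   [ffun p => (h p.1.1 (a p.1.2) (a p.2), mkseq (g p.1.1 (a p.1.2) (a p.2)) l)]).

(* One relation symbol for each possible value of [code]; so the single atomic
   formula naming [code l e] already says everything about [e] at level [l]. *)
Definition overlap_voc : vocabulary :=
  @Vocabulary {N : nat & code_type N} (@tag _ _) void (fun v => match v with end).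

Definition overlap_model : model overlap_voc X :=
  @Model overlap_voc X
    (fun r a => code (tagged r).1.1 a = tagged r) (fun v => match v with end).

Definition code_formula (l N : nat) (e : 'I_N -> X) : qf_formula overlap_voc N :=
  @FRel overlap_voc N (Tagged code_type (code l e)) (@Var overlap_voc N).

Lemma sat_code_formula l N (e a : 'I_N -> X) :
  sat overlap_model (code_formula l e) a <-> code l a = code l e.
Proof. by []. Qed.

Lemma codeP l N (a b : 'I_N -> X) : code l a = code l b ->
  [/\ forall p, mkseq (eta (a p)) l = mkseq (eta (b p)) l,
      forall i p q, h i (a p) (a q) = h i (b p) (b q)
    & forall i p q, mkseq (g i (a p) (a q)) l = mkseq (g i (b p) (b q)) l].
Proof.
move=> [/ffunP eab /ffunP gab]; split=> [p|i p q|i p q].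
- by have := eab p; rewrite !ffunE.
- by have := gab (i, p, q); rewrite !ffunE => -[].
- by have := gab (i, p, q); rewrite !ffunE => -[].
Qed.

(** This pins down [mh] and [mg] only at pairs of distinct nodes, where they matter. *)
Definition represents (m : mtuple iota) (N : nat) (e : 'I_N -> X) : Prop :=
  let r p := mkseq (eta (e p)) (ml m) in
  [/\ forall s, s \in mu m <-> exists p, s = r p, injective r
    & forall p q, p != q -> forall i,
      mh m i (r p) (r q) = h i (e p) (e q) /\
      mg m i (r p) (r q) = mkseq (g i (e p) (e q)) (ml m)].

(** Tree membership and the sum equations pass from branches to restrictions. Absence of repetitions
    need not, and the last hypothesis, that the level separates the branches [g], secures it. *)
Lemma represents_inM m N (e : 'I_N -> X) : 1 < N -> 0 < ml m ->
  injective e -> represents m e ->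
  (forall i j p q p' q',
     mkseq (g i (e p) (e q)) (ml m) = mkseq (g j (e p') (e q')) (ml m) ->
     g i (e p) (e q) = g j (e p') (e q')) ->
  inM T m.
Proof.
move=> N2 m0 e_inj [muP r_inj ghP] sep.
pose r p := mkseq (eta (e p)) (ml m).
split=> //.
- by move=> s /muP[p ->]; rewrite size_mkseq.
- apply: (@two_le_cardfs _ _ (r (Ordinal (ltnW N2))) (r (Ordinal N2))).
  + by apply/muP; eexists.
  + by apply/muP; eexists.
  + by apply/eqP => /r_inj.
- move=> _ _ /muP[p ->] /muP[q ->] neq.
  have pq : p != q by apply: contraNneq neq => ->.
  have qp : q != p by rewrite eq_sym.
  have epq : e p <> e q by move=> /e_inj /eqP; exact/negP.
  have [gT gE g_inj g_neq] := ovl epq.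
  have hg i := ghP _ _ pq i; have hg' i := ghP _ _ qp i.
  split.
  + move=> i; have [-> ->] := hg i; split; [exact: gT|by rewrite size_mkseq].
  + by move=> i; have [_ ->] := hg i; have [_ ->] := hg' i; rewrite !sadd_mkseq gE.
  + rewrite (eq_codom (fun i => (hg i).2)) (eq_codom (fun i => (hg' i).2)) cat_uniq.
    have uniq_codom u v : (injective (fun i => g i (e u) (e v))) ->
        uniq (codom (fun i => mkseq (g i (e u) (e v)) (ml m))).
      by move=> guv; apply/injectiveP => i j /sep/guv.
    rewrite !uniq_codom //=; last first.
      by have [] := ovl (nesym epq).
    rewrite andbT; apply/hasPn => _ /codomP[j ->]; apply/negP => /codomP[i /sep/esym].
    exact: g_neq.
Qed.

Lemma represents_exists n (e : 'I_n.+2 -> X) L : injective e ->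
  exists m, [/\ L < ml m, inM T m & represents m e].
Proof.
move=> e_inj.
have [L1 sep1] := mkseq_separate (fun p => eta (e p)).
have [L2 sep2] := mkseq_separate
  (fun p : 'I_iota * 'I_n.+2 * 'I_n.+2 => g p.1.1 (e p.1.2) (e p.2)).
(* A level above [L] that separates both the [eta (e p)] and all the [g i (e p) (e q)]. *)
pose l := maxn L.+1 (maxn L1 L2).
have Ll : L < l by rewrite leq_maxl.
have {}sep1 := sep1 l; have {}sep2 := sep2 l.
pose r p := mkseq (eta (e p)) l.
have r_inj : injective r.
  by move=> p q /sep1 => /(_ _)/eta_inj/e_inj; apply; rewrite /l !leq_max leqnn orbT.
(* Recovers [e p] from its node; [h] and [g] can thus be transported to sequences. *)
pose pre s := e (odflt ord0 [pick p | r p == s]).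
have preE p : pre (r p) = e p.
  by rewrite /pre; case: pickP => [q /eqP/r_inj -> //|/(_ p)]; rewrite eqxx.
pose m := @MkM iota l [fset r p | p : 'I_n.+2]%fset
  (fun i s t => h i (pre s) (pre t)) (fun i s t => mkseq (g i (pre s) (pre t)) l).
have mR : represents m e.
  split=> //=; last by move=> p q _ i; rewrite -!/(r _) !preE.
  move=> s; split=> [/imfsetP[p _ ->]|[p ->]]; first by exists p.
  by apply/imfsetP; exists p.
exists m; split=> //; apply: represents_inM mR _ => //=; first exact: leq_ltn_trans Ll.
move=> i j p q p' q' /(sep2 _ (i, p, q) (j, p', q')); apply.
by rewrite /l !leq_max leqnn !orbT.
Qed.

Definition extend N (e : 'I_N -> X) (x : X) (p : 'I_N.+1) : X :=
  if unlift ord0 p is Some q then e q else x.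

Lemma extend0 N (e : 'I_N -> X) x : extend e x ord0 = x.
Proof. by rewrite /extend unlift_none. Qed.

Lemma extend_lift N (e : 'I_N -> X) x p : extend e x (lift ord0 p) = e p.
Proof. by rewrite /extend liftK. Qed.

Lemma extend_inj N (e : 'I_N -> X) x :
  injective e -> ~ range e x -> injective (extend e x).
Proof.
move=> e_inj xe p q; case: (unliftP ord0 p) => [p'|] ->; case: (unliftP ord0 q) => [q'|] ->;
  rewrite ?extend0 ?extend_lift //.
- by move=> /e_inj ->.
- by move=> epx; case: xe; exists p'.
- by move=> /esym epx; case: xe; exists q'.
Qed.

Lemma range_extend N (e : 'I_N -> X) x : range (extend e x) = range e `|` [set x].
Proof.
apply/seteqP; split=> [_ [p _ <-]|_ [[p _ <-]|->]].
- case: (unliftP ord0 p) => [p'|] ->; rewrite ?extend0 ?extend_lift; [left|by right].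
  by exists p'.
- by exists (lift ord0 p); rewrite ?extend_lift.
- by exists ord0; rewrite ?extend0.
Qed.

(** At level [ml m] the point [x] cannot be told from [e j], so the longer tuple restricts to the
    picture of [e]. At level [ml n] the nodes of [x] and [e j] differ, so the node of [e j] has
    split. *)
Lemma represents_extend m n N (e : 'I_N -> X) (j : 'I_N) (x : X) :
  represents m e -> code (ml m) (upd e j x) = code (ml m) e ->
  represents n (extend e x) -> ml m < ml n ->
  mext m n /\
  2 <= #|` [fset s in mu n | proper_initial (mkseq (eta (e j)) (ml m)) s]%fset|.
Proof.
move=> [m_mu m_inj m_gh] /codeP[eta_x h_x g_x] [n_mu n_inj n_gh] lmn.
have updj : upd e j x j = x by rewrite /upd eqxx.
have upd_neq p : p != j -> upd e j x p = e p by move=> pj; rewrite /upd (negPf pj).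
have eta_j : mkseq (eta x) (ml m) = mkseq (eta (e j)) (ml m) by rewrite -eta_x updj.
(* [pi p] is the index of the node of [m] below the node with index [p] in [n]; the new point goes
   to [j]. *)
pose pi p := if unlift ord0 p is Some q then q else j.
have pi0 : pi ord0 = j by rewrite /pi unlift_none.
have pi_lift p : pi (lift ord0 p) = p by rewrite /pi liftK.
have takeE p : take (ml m) (mkseq (eta (extend e x p)) (ml n)) =
    mkseq (eta (e (pi p))) (ml m).
  rewrite take_mkseq ?(ltnW lmn) //.
  by case: (unliftP ord0 p) => [q|] ->; rewrite ?extend0 ?extend_lift ?pi0 ?pi_lift.
split; first split; first exact: ltnW.
- apply/fsetP => s; apply/idP/imfsetP => [/m_mu[p ->]|[_ /n_mu[p ->] ->]].
    exists (mkseq (eta (extend e x (lift ord0 p))) (ml n)); last by rewrite takeE pi_lift.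
    by apply/n_mu; exists (lift ord0 p).
  by apply/m_mu; exists (pi p); rewrite takeE.
- move=> _ _ /n_mu[p ->] /n_mu[q ->]; rewrite !takeE => neq i.
  have pq : pi p != pi q by apply: contraNneq neq => ->.
  have pq' : p != q by apply: contraNneq pq => ->.
  have [-> ->] := m_gh _ _ pq i; have [-> ->] := n_gh _ _ pq' i.
  rewrite take_mkseq ?(ltnW lmn) //.
  (* Two old points are immediate. For [x] and an old point other than [e j], equality of codes
     replaces [x] by [e j]. *)
  move: pq; case: (unliftP ord0 p) => [p'|] ->; case: (unliftP ord0 q) => [q'|] ->;
    rewrite ?pi0 ?pi_lift ?extend0 ?extend_lift // => pq.
  + by rewrite -h_x -g_x updj upd_neq.
  + by rewrite -h_x -g_x updj upd_neq // eq_sym.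
  + by rewrite eqxx in pq.
have in_fset p : pi p = j -> mkseq (eta (extend e x p)) (ml n) \in
    [fset s in mu n | proper_initial (mkseq (eta (e j)) (ml m)) s]%fset.
  move=> pj; rewrite !inE /=; apply/andP; split; first by apply/n_mu; exists p.
  rewrite /proper_initial prefixE size_mkseq takeE pj eqxx /=.
  by apply/eqP => /(congr1 size); rewrite !size_mkseq => lE; rewrite lE ltnn in lmn.
(* The two extensions are the nodes of [x] and of [e j]. *)
apply: two_le_cardfs (in_fset _ pi0) (in_fset _ (pi_lift j)) _.
by apply/eqP => /n_inj/eqP; rewrite (negPf (neq_lift _ _)).
Qed.

(** The induction on [a] runs over all tuples [e] and all [m] representing them, because each
    successor step lengthens [e] by one point and raises the level. *)
Lemma rk_ge_ndrk_ge a n (e : 'I_n.+2 -> X) m : injective e -> represents m e ->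
  rk_ge overlap_model a (range e) -> ndrk_ge T a m.
Proof.
elim/(well_founded_ind on_lt_wf): a n e m => a IH n e m e_inj mR.
move wE : (range e) => w aw.
case: aw IH wE => [c {}w c0 _|c {}w c_lim c_lt|c b {}w cS c_ext] IH wE.
- exact: NdrkZero.
- by apply: NdrkLimit => // b /[dup] bc /c_lt; rewrite -wE; exact: IH.
apply: (NdrkSucc cS) => s; case: (mR) => [m_mu _ _] /m_mu[j ->].
(* The node to be split belongs to some [e j]; the formula forces the new point to agree with [e j]
   at level [ml m], relative to the other points. *)
have [] := c_ext _ e _ (code_formula (ml m) e) j; first by split.
  exact/sat_code_formula.
move=> x [xw b_rk /sat_code_formula code_x].
have ex_inj : injective (extend e x) by apply: extend_inj; rewrite ?wE.
have [m' [lmm' m'M m'R]] := represents_exists (ml m) ex_inj.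
have [mm' card2] := represents_extend mR code_x m'R lmm'.
exists m'; split=> //; apply: (IH _ _ _ (extend e x)) => //.
  exact: on_lt_iso (on_lt_onS b) (on_iso_sym cS).
by rewrite range_extend wE.
Qed.

(** A member of M needs two nodes, whereas [w] may be a singleton. If the rank of [w] exceeded [b],
    adding one point would leave rank at least [b], and a tuple representing the larger set would
    contradict [NDRK_ub]. *)
Lemma rk_overlap_model_le b a w : is_NDRK T iota (Fin b) ->
  finite_set w -> w !=set0 -> rk_ge overlap_model a w -> on_le a b.
Proof.
move=> bT w_fin w0; rewrite on_leNgt => aw ba.
have [n [e [e_inj eE]]] := enumerates_exists w_fin w0.
have [c [x [bc xw c_rk]]] := rk_ge_extend (conj e_inj eE) ba aw.
have ex_inj : injective (extend e x) by apply: extend_inj; rewrite ?eE.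
have [m [_ mM mR]] := represents_exists 0 ex_inj.
apply: (NDRK_ub bT mM); apply: ndrk_ge_le bc _.
by apply: (rk_ge_ndrk_ge ex_inj mR); rewrite range_extend eE.
Qed.

End OverlapModel.

(** * Bounding the model rank below [eps] to contradict [Pr eps lam] *)

Theorem corollary3p12 (T : nat -> set (seq bool)) (iota k : nat) (eps om1 lam : ON)
  (treeT : forall n, is_tree (T n))
  (maxT : forall n, no_maximal_nodes (T n))
  (iota2 : 2 <= iota) (kE : k = 2 * iota)
  (om1P : is_omega1 om1) (eps_om1 : on_le eps om1)
  (lam_card : is_cardinal lam) (lam_unc : ~ countable [set: lam])
  (PrH : Pr eps lam)
  (B : set (nat -> bool)) (BE : B = \bigcup_n tree_lim (T n))
  (AH : exists A : set (nat -> bool), A #= [set: lam] /\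
     forall eta nu, A eta -> A nu ->
       `I_k #<= translate B eta `&` translate B nu) :
  exists s : ONinf, is_NDRK T iota s /\ oi_le (Fin eps) s.
Proof.
have [s sT] := NDRK_exists T iota; exists s; split=> //.
case: s sT => [b bT|//]; apply/on_leNgt => b_eps; apply: PrH.
case: AH => A []; rewrite card_eq_sym => /card_set_bijP[eta [etaA eta_inj _]] ovl.
subst k B; have {}eta_inj : injective eta by move=> x y /eta_inj; apply; rewrite inE.
have [h [g hgP]] := overlap_functions eta_inj
  (fun a c => ovl _ _ (etaA a Logic.I) (etaA c Logic.I)).
(* The value -1 lies below everything, and infinity is excluded because it would give rank at least
   [onS b]. *)
have rk_le v : (exists w : set lam,
    [/\ finite_set w, w !=set0 & is_rk (overlap_model eta h g) w v]) ->
    rv_le v (Some (Fin b)).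
  move=> [w [w_fin w0]]; case: v => [[a [aw _]|aw]|//].
    exact: (rk_overlap_model_le eta_inj hgP bT w_fin w0 aw).
  have := rk_overlap_model_le eta_inj hgP bT w_fin w0 (aw (onS b)).
  by move=> /on_leSE/on_lt_irr.
have [s sS] := is_sup_exists rv_least (ex_intro _ _ rk_le).
exists (overlap_voc iota), (overlap_model eta h g), s; split=> //.
(* The supremum is at most [b], and [b] is strictly below [eps]. *)
have {sS} := sS.2 _ rk_le; case: s => [[a|//]|] /=; last by split.
by move=> ab; have a_eps := on_le_lt_trans ab b_eps; split; [left|move/on_leNgt].
Qed.
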